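(* Let $k$ be a field of characteristic $p>0$, let $P$ be a finite poset, $D=J(P)$, $R=\mathcal{R}_k[D]$ the Hibi ring, and $\mathfrak{m}=R_+$ its graded maximal ideal. Then the diagonal $F$-threshold $c^{\mathfrak{m}}(\mathfrak{m})$ exists and \[ c^{\mathfrak{m}}(\mathfrak{m})=\operatorname{rank}^{*}P+2 . \]
   Context: Let $P=\{p_1,\dots,p_N\}$ be a finite poset and $J(P)$ the set of poset ideals of $P$ (subsets $I\subseteq P$ such that $x\in I$, $y\in P$, $y\le x$ imply $y\in I$; including $\emptyset$ and $P$). The Hibi ring is $\mathcal{R}_k[D]=k[\,T\prod_{p_i\in I}X_i \mid I\in J(P)\,]\subseteq k[T,X_1,\dots,X_N]$, graded so that each generator $T\prod_{p_i\in I}X_i$ has degree $1$; $\mathfrak{m}=R_+$ is the ideal generated by these generators. For $q=p^e$, $\mathfrak{m}^{[q]}=(x^q\mid x\in\mathfrak{m})$, $\nu(p^e)=\max\{r\in\mathbb{N}\mid \mathfrak{m}^r\not\subseteq\mathfrak{m}^{[p^e]}\}$, and $c^{\mathfrak{m}}(\mathfrak{m})=\lim_{e\to\infty}\nu(p^e)/p^e$. Poset notions: $x\lessdot y$ ($y$ covers $x$) means $x<y$ and there is no $z$ with $x<z<y$. A path of $P$ is a sequence $C=(q_1,\dots,q_t)$ of distinct elements of $P$ such that $q_1$ is a minimal element of $P$, for each $i$ either $q_i\lessdot q_{i+1}$ or $q_{i+1}\lessdot q_i$, and $q_{t-1}\lessdot q_t$ (when $t\ge 2$). It is maximal if $q_t$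 is a maximal element of $P$. For $1<i<t$, $q_i$ is locally maximal if $q_{i-1}\lessdot q_i$ and $q_{i+1}\lessdot q_i$, and locally minimal if $q_i\lessdot q_{i-1}$ and $q_i\lessdot q_{i+1}$; by convention $q_1$ is locally minimal and $q_t$ is locally maximal. The decomposition $C=A_1+D_1+A_2+\cdots+D_{n-1}+A_n$ splits the sequence $C$ into consecutive blocks: $A_1$ consists of $q_1$ up to and including the first locally maximal element, $D_1$ of the following elements up to and including the next locally minimal element, $A_2$ of the following elements up to and including the next locally maximal element, and so on, with $A_n$ ending at $q_t$. Each $A_i$ is an ascending chain whose last element $t(A_i)$ is locally maximal, and each $D_i$ is a descending chain; $V(\cdot)$ denotes the set of elements of a block. For an ascending block $A$, $\langle A\rangle=\{q\in P\mid q\le t(A)\}$, and $\langle A_i\setminus t(A_i)\rangle$ is the poset ideal of $P$ generated by the elements of $A_i$ other than $t(A_i)$. The path $C$ satisfies condition ( * ) if for all $1\le i\le n-1$: (1) $V(D_i)\cap\bigl(\bigcup_{m=1}^{i-1}\langle A_m\rangle\cup\langle A_i\setminus t(A_i)\rangle\cup\{t(A_i)\}\bigr)=\emptyset$, and (2) $V(A_{i+1})\cap\bigcup_{m=1}^{i}\langle A_m\rangle=\emptyset$. The upper length is $\operatorname{len}^*C=\#\{i\mid q_i\lessdot q_{i+1}\}$. The upper rank is $\operatorname{rank}^*P=\max\{\operatorname{len}^*C\mid C$ a maximal path satisfying ( * )$\}$. *)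

(* Defs.v *)
From HB Require Import structures.
From mathcomp Require Import all_boot all_order all_algebra.
From mathcomp Require Import mpoly.
Set Implicit Arguments. Unset Strict Implicit. Unset Printing Implicit Defensive.
Import Order.Theory GRing.Theory Num.Theory.

Section PosetNotions.
Context {d : Order.disp_t} {P : finPOrderType d}.
Local Open Scope order_scope.

Definition covers (x y : P) : bool :=
  (x < y) && [forall z : P, ~~ ((x < z) && (z < y))].

Definition minimal_elt (x : P) : bool := [forall y : P, ~~ (y < x)].
Definition maximal_elt (x : P) : bool := [forall y : P, ~~ (x < y)].

Definition poset_ideal (I : {set P}) : bool :=
  [forall x in I, forall y : P, (y <= x) ==> (y \in I)].

Definition adj_cov (x y : P) : bool := covers x y || covers y x.

Definition is_path (C : seq P) : bool :=
  if C is x :: s then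
    [&& uniq C, minimal_elt x, path adj_cov x s &
        (size C < 2) || covers (nth x C (size C - 2)) (nth x C (size C - 1))]
  else false.

Definition is_maximal_path (C : seq P) : bool :=
  if C is x :: s then is_path C && maximal_elt (last x s) else false.

Definition len_star (C : seq P) : nat :=
  count (fun xy : P * P => covers xy.1 xy.2) (zip C (behead C)).

Definition loc_max (C : seq P) (i : nat) : bool :=
  match C with
  | [::] => false
  | x :: _ =>
    (i == size C - 1) ||
    [&& 0 < i, i < size C - 1, covers (nth x C i.-1) (nth x C i)
      & covers (nth x C i.+1) (nth x C i)]
  end.

Definition loc_min (C : seq P) (i : nat) : bool :=
  match C with
  | [::] => false
  | x :: _ =>
    (i == 0) ||
    [&& 0 < i, i < size C - 1, covers (nth x C i) (nth x C i.-1)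
      & covers (nth x C i) (nth x C i.+1)]
  end.

(* Block ends of the decomposition C = A_1 + D_1 + A_2 + ... + A_n:
   A_1 ends at the first locally maximal element, each D_i ends at the next
   locally minimal element, each A_{i+1} at the next locally maximal one. *)
Definition block_end (C : seq P) (i : nat) : bool :=
  loc_max C i || ((0 < i) && loc_min C i).

Fixpoint cut_blocks (s : seq (P * bool)) : seq (seq P) :=
  match s with
  | [::] => [::]
  | (x, b) :: s' =>
    if b then [:: x] :: cut_blocks s'
    else match cut_blocks s' with
         | [::] => [:: [:: x]]
         | B :: r => (x :: B) :: r
         end
  end.

(* the list [A_1; D_1; A_2; D_2; ...; D_{n-1}; A_n] *)
Definition blocks (C : seq P) : seq (seq P) :=
  cut_blocks (zip C [seq block_end C i | i <- iota 0 (size C)]).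

(* n = number of ascending blocks *)
Definition nblocks (C : seq P) : nat := (size (blocks C)).+1 %/ 2.
(* 0-based: Ablock C j = A_{j+1}, Dblock C j = D_{j+1} *)
Definition Ablock (C : seq P) (j : nat) : seq P := nth [::] (blocks C) j.*2.
Definition Dblock (C : seq P) (j : nat) : seq P := nth [::] (blocks C) j.*2.+1.

Definition in_down_top (A : seq P) (q : P) : bool :=
  if A is a :: A' then q <= last a A' else false.
Definition is_top (A : seq P) (q : P) : bool :=
  if A is a :: A' then q == last a A' else false.
Definition in_down_butlast (A : seq P) (q : P) : bool :=
  if A is a :: A' then has (fun b => q <= b) (belast a A') else false.

(* condition ( * ), 0-based index j stands for i = j+1, 1 <= i <= n-1 *)
Definition star_cond1 (C : seq P) (j : nat) : bool :=
  all (fun q => [&& ~~ has (fun m => in_down_top (Ablock C m) q) (iota 0 j),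
                    ~~ in_down_butlast (Ablock C j) q
                  & ~~ is_top (Ablock C j) q]) (Dblock C j).

Definition star_cond2 (C : seq P) (j : nat) : bool :=
  all (fun q => ~~ has (fun m => in_down_top (Ablock C m) q) (iota 0 j.+1))
      (Ablock C j.+1).

Definition star (C : seq P) : bool :=
  all (fun j => star_cond1 C j && star_cond2 C j) (iota 0 (nblocks C - 1)).

(* upper rank: max of len_star over maximal paths satisfying ( * ).
   Paths have distinct elements, so their length t satisfies 1 <= t <= #|P|;
   they are enumerated as t-tuples. *)
Definition rank_star : nat :=
  \max_(t < #|P|)
    \max_(c : (t.+1).-tuple P | is_maximal_path c && star c) len_star c.

End PosetNotions.

Section SubringIdeals.
Context {A : comNzRingType}.
Local Open Scope ring_scope.

Definition sub_ideal (S G : A -> Prop) (f : A) : Prop :=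
  exists s : seq (A * A),
    (forall x, x \in s -> S x.1 /\ G x.2) /\ f = \sum_(x <- s) x.1 * x.2.

End SubringIdeals.

Section Hibi.
Context {k : fieldType} {d : Order.disp_t} {P : finPOrderType d}.
Local Open Scope ring_scope.

Notation PR := {mpoly k[#|P|.+1]}.

Definition varT : PR := 'X_ord0.
Definition varX (x : P) : PR := 'X_(lift ord0 (enum_rank x)).

Definition hibi_gen (I : {set P}) : PR := varT * \prod_(x in I) varX x.

Definition is_hibi_gen (g : PR) : Prop :=
  exists I : {set P}, poset_ideal I /\ g = hibi_gen I.

Definition hibi_ring (f : PR) : Prop :=
  exists s : seq (k * seq {set P}),
    (forall x, x \in s -> all poset_ideal x.2) /\
    f = \sum_(x <- s) x.1 *: \prod_(I <- x.2) hibi_gen I.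

Definition hibi_m (f : PR) : Prop := sub_ideal hibi_ring is_hibi_gen f.

(* m^r : ideal of R generated by products of r elements of m, i.e. by
   products of r generators *)
Definition hibi_m_pow (r : nat) (f : PR) : Prop :=
  sub_ideal hibi_ring
    (fun g => exists l : seq {set P},
        [/\ size l = r, all poset_ideal l & g = \prod_(I <- l) hibi_gen I]) f.

Definition hibi_m_frob (q : nat) (f : PR) : Prop :=
  sub_ideal hibi_ring (fun g => exists x, hibi_m x /\ g = x ^+ q) f.

Definition not_in_frob (q r : nat) : Prop :=
  ~ (forall f, hibi_m_pow r f -> hibi_m_frob q f).

Definition is_nu (p : nat) (nu : nat -> nat) : Prop :=
  forall e, not_in_frob (p ^ e) (nu e) /\
            (forall r, not_in_frob (p ^ e) r -> (r <= nu e)%N).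

End Hibi.

Local Open Scope ring_scope.
Definition rat_cvg (u : nat -> rat) (l : rat) : Prop :=
  forall eps : rat, 0 < eps -> exists E : nat,
    forall e, (E <= e)%N -> `|u e - l| < eps.

(* Main.v *)
Require Import Defs.
From HB Require Import structures.
From mathcomp Require Import all_boot all_order all_algebra.
From mathcomp Require Import mpoly zify.
Import Order.Theory GRing.Theory Num.Theory.
Local Open Scope ring_scope.

Set Implicit Arguments.
Unset Strict Implicit.
Unset Printing Implicit Defensive.

(** In fact nu(q) = (q - 1) (rank* P + 2) exactly. The monomials of R are the
    T^n X^v with v : P -> N antitone and bounded by n. Put T at a bottom -oo and
    0 at a top +oo of P. By Frobenius m^[q] is generated by the q-th powers of
    the generators, so T^n X^v lies in m^[q] iff v drops by at least q along
    every cover leaving some ideal I, and outside iff +oo is reachable from -oo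
    by a walk that goes down freely and up only along covers where v drops by
    less than q. Such a walk gives n <= (q - 1) (number of upsteps). On a
    walk with fewest upsteps, no descent in P from one element to a later one
    skips an upstep, and condition ( * ) says precisely this. Conversely, for a
    path satisfying ( * ), counting upsteps from -oo yields an extremal v. *)

(** * Blocks of a path and condition ( * ) *)

Section Blocks.
Context {d : Order.disp_t} {P : finPOrderType d}.
Local Open Scope nat_scope.
Implicit Types (s : seq (P * bool)) (B : seq P) (pr : pred P).

(** A flag closes its block, so the flags strictly before position [i] give the 0-based index of the
    block containing [i]. *)
Definition block_no s i : nat := count snd (take i s).

Lemma cut_blocks_neq0 s : [::] \notin cut_blocks s.
Proof.
elim: s => //= -[x []] s IH /=; first by rewrite inE.
by case: (cut_blocks s) IH => //= B r; rewrite !inE negb_or => /andP[].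
Qed.

Lemma cut_blocks_eq0 s : (cut_blocks s == [::]) = (s == [::]).
Proof. by case: s => //= -[y []] s //=; case: cut_blocks. Qed.

Lemma size_cut_blocks s : last true (map snd s) ->
  size (cut_blocks s) = count snd s.
Proof.
elim: s => //= -[y []] s IH /= lasts; first by case: s lasts IH => //= z s ? ->.
have s_neq0 : s != [::] by case: s lasts {IH}.
have <- : size (cut_blocks s) = count snd s by apply: IH; case: s lasts s_neq0.
by move: s_neq0; rewrite -cut_blocks_eq0; case: cut_blocks.
Qed.

Lemma has_iota_cons (g : P * bool -> bool) z0 a s c :
  has (fun i => (block_no (a :: s) i == c) && g (nth z0 (a :: s) i))
      (iota 0 (size s).+1)
  = ((c == 0) && g a)
    || has (fun i => (a.2 + block_no s i == c) && g (nth z0 s i))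
           (iota 0 (size s)).
Proof.
rewrite /= eq_sym; congr orb.
by rewrite -[1]addn0 iotaDl has_map; apply: eq_has.
Qed.

(** With its analogues for [last] and [belast], this turns questions about blocks into questions
    about positions of [s]. *)
Lemma has_cut_blocks pr z0 s c :
  has pr (nth [::] (cut_blocks s) c)
  = has (fun i => (block_no s i == c) && pr (nth z0 s i).1) (iota 0 (size s)).
Proof.
elim: s c => [|[x b] s IH] c; first by rewrite nth_nil.
rewrite (has_iota_cons (fun z => pr z.1)) /=; case: b => /=.
  case: c => [|c] /=; last by rewrite IH; apply: eq_has => i.
  by rewrite orbF; case: has (has_pred0 (iota 0 (size s))) => //; rewrite orbF.
have -> : has pr (nth [::] match cut_blocks s with
    | [::] => [:: [:: x]] | B :: r => (x :: B) :: r end c)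
  = ((c == 0) && pr x) || has pr (nth [::] (cut_blocks s) c).
  case: (cut_blocks s) => [|B r]; case: c => //= c; rewrite ?orbF //.
  by rewrite nth_nil.
by rewrite IH.
Qed.

(** Only the final block could end without a flag; the hypothesis on the last flag excludes this,
    with the default [true] for empty [s]. *)
Lemma last_cut_blocks pr z0 s c : last true (map snd s) ->
  (if nth [::] (cut_blocks s) c is a :: A then pr (last a A) else false)
  = has (fun i => (block_no s i == c) && ((nth z0 s i).2 && pr (nth z0 s i).1))
        (iota 0 (size s)).
Proof.
elim: s c => [|[x b] s IH] c; first by rewrite nth_nil.
rewrite (has_iota_cons (fun z => z.2 && pr z.1)) /=; case: b => /= lasts.
  have lasts' : last true (map snd s) by case: s lasts {IH}.
  case: c => [|c] /=; last by rewrite IH //; apply: eq_has.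
  by rewrite (@eq_has _ _ pred0) ?has_pred0 ?orbF // => i.
have s_neq0 : s != [::] by case: s lasts {IH}.
have lasts' : last true (map snd s) by case: s lasts {IH s_neq0}.
rewrite andbF /= -IH //.
have := cut_blocks_neq0 s.
move: s_neq0; rewrite -cut_blocks_eq0.
case: (cut_blocks s) => // B r _; rewrite inE negb_or; case: B => // a B _.
by case: c.
Qed.

Lemma belast_cut_blocks pr z0 s c : last true (map snd s) ->
  (if nth [::] (cut_blocks s) c is a :: A then has pr (belast a A) else false)
  = has (fun i => (block_no s i == c)
                  && (~~ (nth z0 s i).2 && pr (nth z0 s i).1))
        (iota 0 (size s)).
Proof.
elim: s c => [|[x b] s IH] c; first by rewrite nth_nil.
rewrite (has_iota_cons (fun z => ~~ z.2 && pr z.1)) /=; case: b => /= lasts.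
  have lasts' : last true (map snd s) by case: s lasts {IH}.
  case: c => [|c] /=; last by rewrite IH //; apply: eq_has.
  by rewrite (@eq_has _ _ pred0) ?has_pred0 ?orbF // => i.
have s_neq0 : s != [::] by case: s lasts {IH}.
have lasts' : last true (map snd s) by case: s lasts {IH s_neq0}.
rewrite /= -IH //.
have := cut_blocks_neq0 s.
move: s_neq0; rewrite -cut_blocks_eq0.
case: (cut_blocks s) => // B r _; rewrite inE negb_or; case: B => // a B _.
by case: c.
Qed.

End Blocks.

Lemma covers_lt {d : Order.disp_t} {P : finPOrderType d} (x y : P) :
  covers x y -> (x < y)%O.
Proof. by case/andP. Qed.

Lemma covers_asym {d : Order.disp_t} {P : finPOrderType d} (x y : P) :
  covers x y -> covers y x = false.
Proof. by move/covers_lt/lt_gtF => yx; rewrite /covers yx. Qed.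

Definition upstep {d : Order.disp_t} {P : finPOrderType d} (x : P) C i :=
  covers (nth x C i) (nth x C i.+1).

(** Even values are the ascending blocks, odd values the descending ones, as in [Ablock] and
    [Dblock]. *)
Definition block_idx {d : Order.disp_t} {P : finPOrderType d} (C : seq P) i :=
  count (block_end C) (iota 0 i).

(** * Positions of a maximal path, parity of the block index, condition ( * ) *)

Section Path.
Context {d : Order.disp_t} {P : finPOrderType d}.
Local Open Scope nat_scope.
Variables (x : P) (s : seq P).
Local Notation C := (x :: s).
Hypothesis C_path : is_maximal_path C.
Local Notation q := (nth x C).
Local Notation up := (upstep x C).
Local Notation b := (block_idx C).


Lemma maximal_path_uniq : uniq C.
Proof. by case/andP: C_path => /and4P[]. Qed.

Lemma upstepN i : i.+1 < size C -> ~~ up i -> covers (q i.+1) (q i).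
Proof.
move=> lti; have /andP[/and4P[_ _ /(pathP x)/(_ i lti)]] := C_path.
by rewrite /upstep /adj_cov /= => /orP[->|].
Qed.

Lemma upstep0 : 1 < size C -> up 0.
Proof.
move=> lt1; apply/negPn/negP => /(upstepN lt1)/covers_lt.
by have /andP[/and4P[_ /forallP/(_ (q 1))/negPf /= ->]] := C_path.
Qed.

Lemma upstep_last : 1 < size C -> up (size C).-2.
Proof.
move=> lt1; have /andP[/and4P[_ _ _]] := C_path.
by rewrite /upstep; case: s lt1 => //= y l _; rewrite subn2 => ->.
Qed.

Lemma block_end_last : block_end C (size C).-1.
Proof. by rewrite /block_end /loc_max subn1 eqxx. Qed.

Lemma block_end0 : 1 < size C -> block_end C 0 = false.
Proof. by rewrite /block_end /loc_max; case: s. Qed.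

Lemma block_end_mid i : i.+2 < size C ->
  block_end C i.+1 = (up i != up i.+1).
Proof.
move=> lti; have lti' : i.+1 < (size C) - 1 by rewrite subn1 -ltnS.
rewrite /block_end /loc_max /loc_min (ltn_eqF lti') !ltEnat /= lti' /=.
have [ui|nui] := boolP (up i).
  rewrite (covers_asym ui) orbF.
  have -> : covers (q i) (nth x s i) by [].
  have [ui1|] := boolP (up i.+1); first by rewrite (covers_asym ui1).
  by move/(upstepN lti) => ->.
have di := upstepN (ltnW lti) nui.
rewrite (covers_asym di) /=; have -> : covers (nth x s i) (q i) by [].
by rewrite /upstep /=; case: covers.
Qed.

Lemma block_idxS i : b i.+1 = b i + block_end C i.
Proof. by rewrite /block_idx -addn1 iotaD count_cat /= addn0. Qed.

Lemma leq_block_idx i j : i <= j -> b i <= b j.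
Proof.
elim: j => [|j IH]; first by rewrite leqn0 => /eqP->.
rewrite leq_eqVlt => /predU1P[->//|]; rewrite ltnS => /IH le.
by rewrite block_idxS (leq_trans le) // leq_addr.
Qed.

(** The first step goes up and the direction flips exactly at block ends. The index is [i.+1]
    because the step from [i] belongs to the block of its target. *)
Lemma upstep_block_idx i : i.+1 < size C -> up i = ~~ odd (b i.+1).
Proof.
elim: i => [|i IH] lti.
  by rewrite block_idxS block_end0 // addn0 upstep0.
rewrite block_idxS block_end_mid // oddD -[~~ _]addTb addbA addTb.
rewrite -IH; last exact: ltnW.
by case: (up i) (up i.+1) => [] [].
Qed.

Lemma odd_block_idx_last : odd (b (size C).-1) = false.
Proof.
case: (ltnP 1 (size C)) => [lt1|]; last by case: s.
have := upstep_last lt1; rewrite upstep_block_idx; last by case: s lt1.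
by case: s lt1 => //= y l _ /negPf.
Qed.

Local Notation z := (zip C [seq block_end C i | i <- iota 0 (size C)]).

Lemma size_flags : size z = size C.
Proof. by rewrite size_zip size_map size_iota minnn. Qed.

Lemma nth_flags i : i < size C -> nth (x, false) z i = (q i, block_end C i).
Proof.
move=> lti; rewrite nth_zip ?size_map ?size_iota //.
by rewrite (nth_map 0) ?size_iota // nth_iota.
Qed.

Lemma block_no_flags i : i <= size C -> block_no z i = b i.
Proof.
move=> lei; rewrite /block_no -(@count_map _ _ snd id) map_take.
rewrite -/(unzip2 _) unzip2_zip ?size_map ?size_iota // -map_take take_iota.
by rewrite count_map (minn_idPl lei); apply: eq_count.
Qed.

Lemma last_flags : last true (map snd z).
Proof.
rewrite -/(unzip2 _) unzip2_zip ?size_map ?size_iota //.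
rewrite -nth_last size_map size_iota (nth_map 0) ?size_iota // nth_iota //.
exact: block_end_last.
Qed.

Lemma mem_blockP c w :
  reflect (exists i, [/\ i < size C, b i = c & w = q i])
          (w \in nth [::] (blocks C) c).
Proof.
rewrite -has_pred1 (has_cut_blocks _ (x, false)) size_flags.
apply: (iffP hasP) => [[i]|[i [lti bi ->]]].
  rewrite mem_iota => lti; rewrite nth_flags // block_no_flags 1?ltnW //.
  by case/andP => /eqP bi /eqP <-; exists i.
exists i; first by rewrite mem_iota.
by rewrite nth_flags // block_no_flags 1?ltnW // bi /= !eqxx.
Qed.

Lemma block_topP (pr : pred P) c :
  reflect (exists i, [/\ i < size C, b i = c, block_end C i & pr (q i)])
  (if nth [::] (blocks C) c is a :: A then pr (last a A) else false).
Proof.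
rewrite (last_cut_blocks _ (x, false)) ?last_flags // size_flags.
apply: (iffP hasP) => [[i]|[i [lti bi ei pri]]].
  rewrite mem_iota => lti; rewrite nth_flags // block_no_flags 1?ltnW //.
  by case/and3P => /eqP bi ei pri; exists i.
exists i; first by rewrite mem_iota.
by rewrite nth_flags // block_no_flags 1?ltnW // bi /= eqxx ei.
Qed.

Lemma block_butlastP (pr : pred P) c :
  reflect (exists i, [/\ i < size C, b i = c, ~~ block_end C i & pr (q i)])
  (if nth [::] (blocks C) c is a :: A then has pr (belast a A) else false).
Proof.
rewrite (belast_cut_blocks _ (x, false)) ?last_flags // size_flags.
apply: (iffP hasP) => [[i]|[i [lti bi ei pri]]].
  rewrite mem_iota => lti; rewrite nth_flags // block_no_flags 1?ltnW //.
  by case/and3P => /eqP bi ei pri; exists i.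
exists i; first by rewrite mem_iota.
by rewrite nth_flags // block_no_flags 1?ltnW // bi /= eqxx ei.
Qed.

Lemma nblocksE : nblocks C = (b (size C).-1)./2.+1.
Proof.
rewrite /nblocks size_cut_blocks ?last_flags //.
have -> : count snd z = b (size C).
  by rewrite -block_no_flags // /block_no take_oversize ?size_flags.
rewrite -[size C]prednK // block_idxS block_end_last /= addn1 divn2 /=.
by [].
Qed.

Lemma even_block_top i : i < size C -> ~~ odd (b i) ->
  exists t, [/\ t < size C, b t = b i, block_end C t & (q i <= q t)%O].
Proof.
have [n] := ubnP (size C - i); elim: n i => // n IH i ltn lti ev.
have [ei|nei] := boolP (block_end C i); first by exists i.
have lti1 : i.+1 < size C.
  rewrite ltn_neqAle lti andbT; apply: contra nei => /eqP sz.
  by have := block_end_last; rewrite -sz.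
have bi : b i.+1 = b i by rewrite block_idxS (negPf nei) addn0.
have [||t [ltt bt et le]] := IH i.+1 _ lti1; rewrite ?bi //; first by lia.
exists t; split=> //; first by rewrite bt.
apply: le_trans le; apply/ltW/covers_lt; rewrite -[covers _ _]/(up i).
by rewrite upstep_block_idx // bi.
Qed.

(** A descending block lies below the top of the ascending block just before it; hence the rounding
    down to an even index. *)
Lemma block_top i : i < size C ->
  exists t, [/\ t < size C, b t = (b i)./2.*2, block_end C t & (q i <= q t)%O].
Proof.
elim: i => [|i IH] lti; first by have := even_block_top lti isT.
have [od|ev] := boolP (odd (b i.+1)); last first.
  have [t [? bt ? ?]] := even_block_top lti ev; exists t; split=> //.
  by rewrite bt even_halfK.
have [t [ltt bt et le]] := IH (ltnW lti).
have : (q i.+1 <= q i)%O.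
  apply/ltW/covers_lt/upstepN => //.
  by rewrite upstep_block_idx // negbK.
move=> le1; have le2 := le_trans le1 le; move: bt od; rewrite block_idxS.
case: (block_end C i) => bt od; last by rewrite addn0; exists t.
by exists t; split=> //; rewrite bt; lia.
Qed.

Lemma block_idx_const i j : i <= j ->
  (forall k, i <= k <= j -> odd (b k)) -> b j = b i.
Proof.
elim: j => [|j IH]; first by rewrite leqn0 => /eqP->.
rewrite leq_eqVlt => /predU1P[->//|]; rewrite ltnS => leij od.
have bj : b j = b i by apply: IH => // k; move=> ?; apply: od; lia.
have : odd (b j.+1) by apply: od; lia.
have : odd (b j) by apply: od; lia.
by rewrite -bj block_idxS; case: block_end; lia.
Qed.

Lemma even_block_lt i j : i < j -> j < size C -> b i = b j -> ~~ odd (b j) ->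
  (q i < q j)%O.
Proof.
elim: j => // j IH; rewrite ltnS => leij ltj bij ev.
have bj : b j = b j.+1.
  by apply/eqP; rewrite eqn_leq -{2}bij !leq_block_idx.
have qj : (q j < q j.+1)%O.
  by apply: covers_lt; rewrite -[covers _ _]/(up j) upstep_block_idx.
have [->//|neij] := eqVneq i j.
apply: (lt_trans _ qj); apply: IH; last by rewrite bj.
- by rewrite ltn_neqAle neij.
- exact: ltnW.
- by rewrite bij.
Qed.

(** Both clauses of ( * ) forbid a late element to lie below an element of an earlier block, except
    along the descent that directly follows it. So an element below an earlier one is reached from
    it by downsteps alone. *)
Lemma starP :
  star C <-> forall i j, i < j -> j < size C -> (q j <= q i)%O ->
             forall k, i <= k < j -> ~~ up k.
Proof.
have ltb i j : b i < b j -> i < j.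
  by apply: contraTltn; rewrite -leqNgt; apply: leq_block_idx.
rewrite /star nblocksE subn1 /=; split.
  move=> /allP starC i j ltij ltj leji k /andP[leik ltkj].
  have lti := ltn_trans ltij ltj.
  have bij : b i.+1 <= b k.+1 by apply: leq_block_idx.
  have bkj : b k.+1 <= b j by apply: leq_block_idx.
  have bj : b j <= b (size C).-1 by apply: leq_block_idx.
  rewrite upstep_block_idx ?(leq_ltn_trans ltkj) // negbK.
  apply/negPn/negP => evk.
  have oddlast := odd_block_idx_last.
  have [t [ltt bt et le]] := block_top lti.
  have lejt := le_trans leji le.
  have bSi := block_idxS i.
  have topP c : b i = c.*2 \/ b i = c.*2.+1 -> in_down_top (Ablock C c) (q j).
    move=> bic; apply/(block_topP (fun a => (q j <= a)%O)); exists t.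
    by split=> //; rewrite bt; lia.
  have in_range c : c < (b (size C).-1)./2 -> c \in iota 0 (b (size C).-1)./2.
    by rewrite mem_iota.
  have [odj|evj] := boolP (odd (b j)).
    have ltj2 : (b j)./2 < (b (size C).-1)./2 by lia.
    have /andP[/allP/(_ (q j)) cond _] := starC _ (in_range _ ltj2).
    have jD : q j \in Dblock C (b j)./2.
      by apply/mem_blockP; exists j; split=> //; lia.
    have {cond jD} /and3P[c1 c2 _] := cond jD.
    case: (ltnP (b i)./2 (b j)./2) => [lt2|ge2].
      move/hasPn: c1 => /(_ (b i)./2); rewrite mem_iota lt2 => /(_ isT).
      by rewrite topP //; lia.
    (* Now [b i] is [b j - 1], and the upstep at [k] prevents [i] from ending its block, so [q i] is
       a non-top element of that ascending block. *)
    move/negP: c2; apply; apply/(block_butlastP (fun a => (q j <= a)%O)).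
    by exists i; split=> //; [|apply/negP => ei; rewrite ei in bSi]; lia.
  (* Inside one ascending block the path increases, so [i] lies in an earlier block and clause (2)
     is violated. *)
  have lebij : b i <= b j by apply/leq_block_idx/ltnW.
  have nbij : b i != b j.
    apply/eqP => bijE; have := even_block_lt ltij ltj bijE evj.
    by move/lt_geF; rewrite leji.
  have ltj2 : (b j)./2.-1 < (b (size C).-1)./2 by lia.
  have /andP[_ /allP/(_ (q j)) cond] := starC _ (in_range _ ltj2).
  have jA : q j \in Ablock C (b j)./2.-1.+1.
    by apply/mem_blockP; exists j; split=> //; lia.
  move/hasPn: (cond jA) => /(_ (b i)./2).
  by rewrite mem_iota topP => [|]; lia.
move=> geod; apply/allP => j; rewrite mem_iota /= add0n => ltj.
(* A descent from ascending block [c] to a later block contains no upstep, so it starts at the top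
   of block [c] and stays in the next descending block. *)
have lt_up i i' c : b i' = c.*2 -> i < size C -> c.*2 < b i ->
    (q i <= q i')%O -> b i = c.*2.+1 /\ block_end C i'.
  move=> bi' lti bi le.
  have lti' : i' < i by apply: ltb; rewrite bi'.
  have od k : i' < k <= i -> odd (b k).
    case: k => // k /andP[? ?]; apply/negPn; rewrite -upstep_block_idx //.
      by apply: (geod i' i lti' lti le); apply/andP.
    exact: leq_ltn_trans lti.
  have bii' : b i = b i'.+1 by apply: block_idx_const => // k /od.
  have := od i'.+1; rewrite ltnS leqnn lti' => /(_ isT).
  by rewrite bii' block_idxS bi'; case: block_end => /=; [split=> //|]; lia.
apply/andP; split; apply/allP => w /mem_blockP[i [lti bi ->]].
  apply/and3P; split.
  - apply/hasPn => m; rewrite mem_iota /= => ltm.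
    apply/negP => /(block_topP (fun a => (q i <= a)%O))[i' [_ bi' _ le]].
    by have [] := lt_up _ _ _ bi' lti _ le; lia.
  - apply/negP => /(block_butlastP (fun a => (q i <= a)%O))[i' [_ bi' ei' le]].
    by have [] := lt_up _ _ _ bi' lti _ le; [lia|rewrite (negPf ei')].
  - apply/negP => /(block_topP (fun a => q i == a))[i' [lti' bi' _]].
    rewrite (nth_uniq _ lti lti' maximal_path_uniq) => /eqP ii'.
    by move: bi; rewrite ii' bi'; lia.
apply/hasPn => m; rewrite mem_iota /= => ltm.
apply/negP => /(block_topP (fun a => (q i <= a)%O))[i' [_ bi' _ le]].
by have [] := lt_up _ _ _ bi' lti _ le; lia.
Qed.

End Path.

(** * Walks with few upsteps *)

Section Chains.
Context {d : Order.disp_t} {P : finPOrderType d}.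
Local Open Scope nat_scope.
Implicit Types (a b x y z : P) (s : seq P).

(** A strictly larger element has a strictly larger principal ideal, so maximizing the cardinality
    of the latter suffices. *)
Lemma ex_maximal_in (Q : pred P) y : Q y ->
  exists2 z, Q z & forall w, Q w -> ~~ (z < w)%O.
Proof.
move=> Qy.
have [z Qz zmax] := @arg_maxnP _ y Q (fun z => #|[set w | (w <= z)%O]|) Qy.
exists z => // w /zmax /=; rewrite leqNgt; apply: contra => ltzw.
apply/proper_card/properP; split.
  by apply/subsetP => t; rewrite !inE => /le_trans; apply; apply: ltW.
by exists w; rewrite !inE ?lexx // lt_geF.
Qed.

Lemma ex_minimal_in (Q : pred P) y : Q y ->
  exists2 z, Q z & forall w, Q w -> ~~ (w < z)%O.
Proof.
move=> Qy.
have [z Qz zmin] := @arg_minnP _ y Q (fun z => #|[set w | (w <= z)%O]|) Qy.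
exists z => // w /zmin /=; rewrite leqNgt; apply: contra => ltwz.
apply/proper_card/properP; split.
  by apply/subsetP => t; rewrite !inE => /le_trans; apply; apply: ltW.
by exists z; rewrite !inE ?lexx // lt_geF.
Qed.

Lemma maximal_above y : exists2 z, maximal_elt z & (y <= z)%O.
Proof.
have [z lez zmax] := @ex_maximal_in (fun z => (y <= z)%O) y (lexx y).
exists z => //; apply/forallP => w; apply/negP => ltzw.
by have := zmax w (le_trans lez (ltW ltzw)); rewrite ltzw.
Qed.

Lemma minimal_below y : exists2 z, minimal_elt z & (z <= y)%O.
Proof.
have [z lez zmin] := @ex_minimal_in (fun z => (z <= y)%O) y (lexx y).
exists z => //; apply/forallP => w; apply/negP => ltwz.
by have := zmin w (le_trans (ltW ltwz) lez); rewrite ltwz.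
Qed.

(** The chain is listed downwards from [b], ready to be spliced into a walk as a run of
    downsteps. *)
Lemma covers_chain a b : (a <= b)%O ->
  exists2 c, path (fun y z => covers z y) b c & last b c = a.
Proof.
have [n] := ubnP #|[set w | (w <= b)%O]|; elim: n b => // n IH b ltn leab.
have [->|neab] := eqVneq a b; first by exists [::].
have ltab : (a < b)%O by rewrite lt_neqAle neab.
have [z /andP[leaz ltzb] zmax] :=
  @ex_maximal_in (fun z => (a <= z)%O && (z < b)%O) a
    (introT andP (conj (lexx a) ltab)).
have czb : covers z b.
  rewrite /covers ltzb; apply/forallP => w; apply/negP => /andP[ltzw ltwb].
  by have := zmax w; rewrite ltzw ltwb (le_trans leaz (ltW ltzw)) => /(_ isT).
have [|c pc lc] := IH z _ leaz; last by exists (z :: c); rewrite //= czb.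
rewrite -ltnS; apply: leq_trans ltn; apply/proper_card/properP; split.
  by apply/subsetP => t; rewrite !inE => /le_trans; apply; apply: ltW.
by exists b; rewrite !inE ?lexx // lt_geF.
Qed.

Lemma len_star_cons x y s :
  len_star [:: x, y & s] = covers x y + len_star (y :: s).
Proof. by []. Qed.

Lemma len_star_cat x s1 s2 :
  len_star (x :: s1 ++ s2) = len_star (x :: s1) + len_star (last x s1 :: s2).
Proof.
elim: s1 x => [|y s1 IH] x; first by [].
by rewrite !cat_cons !len_star_cons IH addnA.
Qed.

Lemma len_star_descent b c :
  path (fun y z => covers z y) b c -> len_star (b :: c) = 0.
Proof.
elim: c b => // y c IH b /= /andP[cyb /IH].
by rewrite len_star_cons => ->; rewrite (covers_asym cyb).
Qed.

Lemma last_take x s i : i <= size s -> last x (take i s) = nth x (x :: s) i.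
Proof.
move=> lei; rewrite (last_nth x) size_takel //.
by case: i lei => //= i lei; rewrite nth_take.
Qed.

Lemma len_star_takeS x s i : i < size s ->
  len_star (x :: take i.+1 s)
  = len_star (x :: take i s) + upstep x (x :: s) i.
Proof.
move=> lti; rewrite (take_nth x lti) -cats1 len_star_cat last_take 1?ltnW //.
by rewrite len_star_cons addn0.
Qed.

Lemma leq_len_star_take x s i j : i <= j -> j <= size s ->
  len_star (x :: take i s) <= len_star (x :: take j s).
Proof.
elim: j => [|j IH]; first by rewrite leqn0 => /eqP->.
rewrite leq_eqVlt => /predU1P[->//|]; rewrite ltnS => leij ltj.
by rewrite len_star_takeS // (leq_trans (IH leij (ltnW ltj))) // leq_addr.
Qed.

(** This restates the criterion of [starP] by upper lengths of prefixes. *)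
Lemma len_star_takeP x s i j : i <= j -> j <= size s ->
  len_star (x :: take i s) = len_star (x :: take j s) <->
  (forall k, i <= k < j -> ~~ upstep x (x :: s) k).
Proof.
elim: j => [|j IH]; first by rewrite leqn0 => /eqP-> _; split=> // _ k; lia.
rewrite leq_eqVlt => /predU1P[->//|]; first by split=> // _ k; lia.
rewrite ltnS => leij ltj; rewrite len_star_takeS //.
have le := leq_len_star_take x leij (ltnW ltj); split=> [eqij k lek|noup].
  have [nj IH'] : ~~ upstep x (x :: s) j /\
      len_star (x :: take i s) = len_star (x :: take j s).
    by move: eqij le; case: upstep => //=; lia.
  have [->//|nekj] := eqVneq k j.
  by apply: (proj1 (IH leij (ltnW ltj)) IH'); lia.
have /negPf-> : ~~ upstep x (x :: s) j by apply: noup; lia.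
by rewrite addn0; apply/IH => // [|k lek]; [lia | apply: noup; lia].
Qed.

End Chains.

Definition antitone {d : Order.disp_t} {P : finPOrderType d} (v : P -> nat) :=
  forall x y, (x <= y)%O -> (v y <= v x)%N.

(** * Walks for a weight [v], shortcuts, and the ideal of reached elements *)

Section Walks.
Context {d : Order.disp_t} {P : finPOrderType d}.
Local Open Scope nat_scope.
Variables (v : P -> nat) (n q : nat).
Hypotheses (v_anti : antitone v) (v_le : forall x, v x <= n) (q_gt0 : 0 < q).

Definition walk_step : rel P :=
  fun a b => covers a b && (v a < v b + q) || covers b a.

(** The two numerical end conditions are upsteps as well: from -oo, of weight [n], to the first
    element, and from the last element to +oo, of weight 0. *)
Definition walk (C : seq P) : bool :=
  if C is x :: s then
    [&& minimal_elt x, n < v x + q, path walk_step x s,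
        maximal_elt (last x s) & v (last x s) < q]
  else false.

Definition reached : {set P} :=
  [set y | [exists x, [&& minimal_elt x, n < v x + q & connect walk_step x y]]].

Lemma walk_step_descent b c :
  path (fun y z => covers z y) b c -> path walk_step b c.
Proof. by apply: sub_path => y z; rewrite /walk_step => ->; rewrite orbT. Qed.

(** Each upstep loses at most [q - 1] and a downstep loses nothing, [v] being antitone. The summand
    2 counts the steps from -oo and to +oo. *)
Lemma walk_bound x s : walk (x :: s) -> n <= q.-1 * (len_star (x :: s) + 2).
Proof.
case/and5P => _ nx ps _ vl.
suff : v x <= v (last x s) + q.-1 * len_star (x :: s) by nia.
elim: s x ps {nx vl} => [|y s IH] x /=; first by rewrite leq_addr.
case/andP=> /orP[/andP[cxy vxy]|cyx] /IH; rewrite len_star_cons.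
  by rewrite cxy; nia.
rewrite (covers_asym cyx) add0n; apply: leq_trans.
exact/v_anti/ltW/covers_lt.
Qed.

(** The stretch from [i] to [j] is replaced by a chain of covers going down, which has no upstep.
    For equal endpoints that chain is empty and a loop is cut out. *)
Lemma walk_shortcut x s i j : walk (x :: s) -> i < j -> j <= size s ->
  (nth x (x :: s) j <= nth x (x :: s) i)%O ->
  exists s', [/\ walk (x :: s'),
    len_star (x :: s') + len_star (x :: take j s)
      = len_star (x :: s) + len_star (x :: take i s)
    & nth x (x :: s) j = nth x (x :: s) i -> size s' < size s].
Proof.
move=> /and5P[mx nx ps ml vl] ltij lej leji.
have [c pc lc] : exists2 c, path (fun y z => covers z y) (nth x (x :: s) i) c
     & last (nth x (x :: s) i) c = nth x (x :: s) j /\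
       (nth x (x :: s) j = nth x (x :: s) i -> c = [::]).
  have [eqji|neqji] := eqVneq (nth x (x :: s) j) (nth x (x :: s) i).
    by exists [::].
  have [c pc lc] := covers_chain leji; exists c => //; split=> // /eqP.
  by rewrite (negPf neqji).
case: lc => lc c_nil.
have lei : i <= size s := leq_trans (ltnW ltij) lej.
have li := last_take x lei; have lj := last_take x lej.
exists (take i s ++ c ++ drop j s).
have psi : path walk_step x (take i s).
  by move: ps; rewrite -{1}(cat_take_drop i s) cat_path => /andP[].
have psj : path walk_step (nth x (x :: s) j) (drop j s).
  by move: ps; rewrite -{1}(cat_take_drop j s) cat_path lj => /andP[].
have lastE : last x (take i s ++ c ++ drop j s) = last x s.
  by rewrite !last_cat li lc -lj -last_cat cat_take_drop.
split.
- rewrite /walk mx nx lastE ml vl !cat_path psi li walk_step_descent //.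
  by rewrite lc psj.
- rewrite !len_star_cat li lc (len_star_descent pc).
  have := len_star_cat x (take j s) (drop j s); rewrite cat_take_drop lj; lia.
- by move/c_nil->; rewrite size_cat size_takel // size_drop; lia.
Qed.

(* Lexicographic descent on (upper length, size): splicing in a shortcut lowers
   the upper length, and cutting out a loop lowers the size. *)
Lemma walk_star_path C : walk C ->
  exists C' : seq P,
    [/\ is_maximal_path C', star C' & n <= q.-1 * (len_star C' + 2)].
Proof.
have [N] := ubnP (len_star C); elim: N C => // N IHN C.
have [M] := ubnP (size C); elim: M C => // M IHM [|x s] // ltM ltN wC.
have [/existsP[i /existsP[j]]|] := boolP
  [exists i : 'I_(size s).+1, exists j : 'I_(size s).+1,
    [&& i < j, (nth x (x :: s) j <= nth x (x :: s) i)%O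
     & (nth x (x :: s) j == nth x (x :: s) i)
       || (len_star (x :: take i s) != len_star (x :: take j s))]].
  case/and3P=> ltij leji bad.
  have lej : j <= size s by rewrite -ltnS.
  have [s' [w' lenE szE]] := walk_shortcut wC ltij lej leji.
  have le := leq_len_star_take x (ltnW ltij) lej.
  have [eqij|neij] := eqVneq (len_star (x :: take i s))
                             (len_star (x :: take j s)).
    move: bad; rewrite eqij eqxx orbF => /eqP/szE ltsz.
    by apply: (IHM (x :: s')) => //; move: ltM => /= ltM; lia.
  by apply: (IHN (x :: s')) => //; lia.
move=> /existsPn good; exists (x :: s).
have {}good i j : i < j -> j < size (x :: s) ->
    (nth x (x :: s) j <= nth x (x :: s) i)%O ->
    nth x (x :: s) j != nth x (x :: s) i /\
    len_star (x :: take i s) = len_star (x :: take j s).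
  move=> ltij ltj leji; have lti := ltn_trans ltij ltj.
  have /existsPn/(_ (Ordinal ltj)) /= := good (Ordinal lti).
  by rewrite ltij leji /= negb_or negbK => /andP[? /eqP].
have bound := walk_bound wC; move/and5P: wC => [mx nx ps ml vl].
have padj : path adj_cov x s.
  apply: sub_path ps => a b; rewrite /adj_cov.
  by case/orP=> [/andP[-> _]|->]; rewrite ?orbT.
have C_uniq : uniq (x :: s).
  apply/(uniqP x) => i j; rewrite !inE.
  wlog ltij : i j / i < j => [wl lti ltj eqij|lti ltj eqij].
    by case: (ltngtP i j) => // lt; [|apply/esym]; apply: wl.
  by have [] := good i j ltij ltj; rewrite eqij ?eqxx.
have C_path : is_maximal_path (x :: s).
  rewrite /is_maximal_path ml andbT /is_path C_uniq mx padj /=.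
  (* The last step of a path has to be an upstep: a downstep cannot end in a maximal element. *)
  case: s padj ml {good bound ps vl ltM ltN C_uniq} => //= y s padj ml.
  rewrite subn2 /=; move: padj.
  rewrite -[_ && _]/(path adj_cov x (y :: s)) => /(pathP x).
  move=> /(_ (size s) (leqnn _))/orP[//|]/covers_lt lt.
  have /forallP := ml; move/(_ (nth x (x :: y :: s) (size s))).
  by have := nth_last x (y :: s); move: lt => /= /[swap] -> ->.
split=> //; apply/(starP C_path) => i j ltij ltj leji.
apply/len_star_takeP => //; first exact: ltnW.
by have [] := good _ _ ltij ltj leji.
Qed.

Lemma reached_ideal : poset_ideal reached.
Proof.
apply/forall_inP => y; rewrite inE => /existsP[x /and3P[mx nx cxy]].
apply/forallP => z; apply/implyP => lezy; rewrite inE; apply/existsP; exists x.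
rewrite mx nx; apply: connect_trans cxy _.
have [c /walk_step_descent pc lc] := covers_chain lezy.
by apply/connectP; exists c.
Qed.

(** A chain of covers from [x] to [y] leaves [reached] along some cover. That cover is not a walk
    step, so [v] drops by at least [q] there, and it does not increase elsewhere. *)
Lemma reached_gap x y : (x <= y)%O -> x \in reached -> y \notin reached ->
  v y + q <= v x.
Proof.
move=> /covers_chain[c]; elim: c y => [|z c IH] y /=.
  by move=> _ -> ->.
move=> /andP[czy pc] lc xr yr.
have lezy := ltW (covers_lt czy).
have [zr|zr] := boolP (z \in reached); last first.
  by apply: leq_trans (IH z pc lc xr zr); rewrite leq_add2r; apply: v_anti.
have vyz : v y + q <= v z.
  rewrite leqNgt; apply: contra yr => lt.
  move: zr; rewrite !inE => /existsP[t /and3P[mt nt ctz]].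
  apply/existsP; exists t; rewrite mt nt; apply: connect_trans ctz _.
  by apply: connect1; rewrite /walk_step czy lt.
apply: leq_trans vyz _; apply: v_anti; rewrite -lc.
elim: c z pc {IH lc czy lezy zr} => //= w c IH z /andP[cwz /IH].
by move/le_trans; apply; apply/ltW/covers_lt.
Qed.

(** If +oo is reachable there is a walk, and it can be straightened to a path with ( * ). Otherwise
    [reached] serves as [I]: the four conditions are the drops by [q] between -oo and +oo, inside
    and across the cut, that allow division by the [q]-th power of the generator of [I]. *)
Lemma ideal_or_star_path : 0 < #|P| ->
  (exists2 I : {set P}, poset_ideal I &
     [/\ q <= n, forall x, x \in I -> q <= v x,
         forall x, x \notin I -> v x + q <= n
       & forall x y, (x <= y)%O -> x \in I -> y \notin I -> v y + q <= v x])
  \/ (exists C : seq P,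
       [/\ is_maximal_path C, star C & n <= q.-1 * (len_star C + 2)]).
Proof.
move=> /card_gt0P[p0 _].
have [/exists_inP[y]|/exists_inPn no_end] :=
    boolP [exists y in reached, maximal_elt y && (v y < q)].
  rewrite inE => /existsP[x /and3P[mx nx /connectP[s ps ->]]] /andP[my vy].
  by right; apply: (@walk_star_path (x :: s)); apply/and5P.
left; exists reached; first exact: reached_ideal.
(* The drop from [x] to +oo, seen through a maximal element above [x]. *)
have in_r x : x \in reached -> q <= v x.
  move=> xr; have [z mz lexz] := maximal_above x.
  have [zr|zr] := boolP (z \in reached).
    have := no_end z zr; rewrite mz -leqNgt => /leq_trans; apply.
    exact: v_anti.
  by apply: leq_trans (reached_gap lexz xr zr); rewrite leq_addl.
(* The drop from -oo to [x], seen through a minimal element below [x]. *)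
have out_r x : x \notin reached -> v x + q <= n.
  move=> xr; have [z mz lezx] := minimal_below x.
  have [zr|zr] := boolP (z \in reached).
    exact: leq_trans (reached_gap lezx zr xr) (v_le z).
  apply: (@leq_trans (v z + q)); first by rewrite leq_add2r v_anti.
  rewrite leqNgt; apply: contra zr => nz.
  by rewrite inE; apply/existsP; exists z; rewrite mz nz connect0.
split=> //; last by move=> x y; apply: reached_gap.
have [r|r] := boolP (p0 \in reached).
  exact: leq_trans (in_r _ r) (v_le p0).
by apply: leq_trans (out_r _ r); rewrite leq_addl.
Qed.

End Walks.

(** Used with [r = q - 1]. The weight falls by exactly [r] along every upstep of [C], those from -oo
    and to +oo included. Splitting off the [q]-th power of the generator of [I] needs a fall of at
    least [r + 1] wherever [I] is left, so [C] could never leave [I] on its way to +oo. *)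
Lemma star_path_weight {d : Order.disp_t} {P : finPOrderType d} (C : seq P) r :
  is_maximal_path C -> star C ->
  exists v : P -> nat, [/\ antitone v,
    forall y, (v y <= r * (len_star C + 2))%N
  & forall (I : {set P}) (w : P -> nat) m,
      poset_ideal I -> antitone w -> (forall y, (w y <= m)%N) ->
      (r * (len_star C + 2) = r.+1 + m)%N ->
      ~ (forall y, v y = (y \in I) * r.+1 + w y)%N].
Proof.
case: C => // x s C_path /(starP C_path) geod.
pose q := nth x (x :: s); pose len := len_star (x :: s).
pose u i := len_star (x :: take i s).
have u_le i : (u i <= len)%N.
  rewrite /u /len -{2}(take_size s); case: (leqP i (size s)) => [|/ltnW] le.
    exact: leq_len_star_take.
  by rewrite (take_oversize le) take_size.
(* [(u i).+1] counts the upsteps from -oo to [q i], so that [v y / r] is the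
   number of upsteps in P with +oo added minus the least number of upsteps
   needed to reach [y] going up along the path and down freely. *)
pose v y := \max_(i < (size s).+1 | (y <= q i)%O) (r * (len.+1 - u i))%N.
have v_up y (i : 'I_(size s).+1) :
    (y <= q i)%O -> (r * (len.+1 - u i) <= v y)%N.
  by move=> le; rewrite /v; apply: (leq_bigmax_cond i).
(* On the path the maximum is attained at [j]: later positions have [u] at least as large, and by (
   * ) an earlier position above [q j] has the same [u]. *)
have vq j : (j < (size s).+1)%N -> v (q j) = (r * (len.+1 - u j))%N.
  move=> ltj; apply/eqP; rewrite eqn_leq (v_up _ (Ordinal ltj)) // andbT.
  apply/bigmax_leqP => i leji; rewrite leq_mul2l; apply/orP; right.
  apply: leq_sub2l; have [leij|ltij] := leqP j i.
    by apply: leq_len_star_take; rewrite // -ltnS.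
  suff -> : u i = u j by [].
  by apply/len_star_takeP; [exact: ltnW| |exact: geod].
exists v; split.
- move=> y z leyz; apply/bigmax_leqP => i lezi.
  exact/v_up/(le_trans leyz).
- move=> y; apply/bigmax_leqP => i _; rewrite leq_mul2l; apply/orP; right; lia.
move=> I w m I_ideal w_anti w_le rE vE.
have down a b : (b <= a)%O -> a \in I -> b \in I.
  move=> leba aI; move: I_ideal => /forall_inP/(_ a aI)/forallP/(_ b).
  by rewrite leba.
(* The path enters [I] at its first element, since a fall of [r] from -oo is too small to skip [I].
   Upsteps fall too little to leave [I], and downsteps stay in an ideal. *)
have inI j : (j < (size s).+1)%N -> q j \in I.
  elim: j => [_|j IH ltj].
    apply/negPn/negP => xI; have := vE (q 0); rewrite vq // (negPf xI) mul0n.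
    by have := w_le (q 0); rewrite /u take0 /len_star /= -/len; lia.
  have qjI := IH (ltnW ltj); have [up|nup] := boolP (upstep x (x :: s) j).
    apply/negPn/negP => nI; have := vE (q j); have := vE (q j.+1).
    rewrite !vq ?(ltnW ltj) // qjI (negPf nI) /u len_star_takeS // up.
    rewrite mul0n mul1n.
    have := w_anti _ _ (ltW (covers_lt up)); have := u_le j.+1.
    by rewrite /u len_star_takeS // up -!/(q _) -/(u j) /=; nia.
  exact: down (ltW (covers_lt (upstepN C_path ltj nup))) qjI.
(* The last element has weight [r], while membership in [I] requires at least [r + 1]. *)
have := vE (q (size s)); rewrite vq // inI // /u take_size -/len subSnn; lia.
Qed.

(** * Monomials of the Hibi ring *)

Section SubIdeal.
Context {A : comNzRingType}.
Implicit Types (S G : A -> Prop) (f g : A).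

Lemma sub_ideal_sum S G (T : eqType) (r : seq T) (F : T -> A) :
  (forall t, t \in r -> sub_ideal S G (F t)) ->
  sub_ideal S G (\sum_(t <- r) F t).
Proof.
elim: r => [|t r IH] Fr; first by rewrite big_nil; exists [::]; rewrite big_nil.
have [s1 [s1P Er]] : sub_ideal S G (\sum_(t <- r) F t).
  by apply: IH => u ur; apply: Fr; rewrite inE ur orbT.
have [s2 [s2P Ft]] := Fr t (mem_head _ _).
exists (s2 ++ s1); rewrite big_cons Er Ft big_cat; split=> // x.
by rewrite mem_cat => /orP[/s2P|/s1P].
Qed.

Lemma sub_ideal_mul S G f g : S f -> G g -> sub_ideal S G (f * g).
Proof.
move=> Sf Gg; exists [:: (f, g)]; rewrite big_seq1; split=> // x.
by rewrite inE => /eqP->.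
Qed.

Lemma sub_ideal_trans S G G' f :
  (forall a g, S a -> G g -> sub_ideal S G' (a * g)) ->
  sub_ideal S G f -> sub_ideal S G' f.
Proof.
move=> GG' [s [sP ->]]; apply: sub_ideal_sum => x /sP[Sx Gx].
exact: GG'.
Qed.

End SubIdeal.

Lemma expr_sum_pchar (A : comNzRingType) (T : Type) (r : seq T) (F : T -> A) q :
  [pchar A].-nat q -> (\sum_(t <- r) F t) ^+ q = \sum_(t <- r) F t ^+ q.
Proof.
move=> pq; have q_gt0 : (0 < q)%N by case/andP: pq.
apply: (big_morph (fun x => x ^+ q)) => [x y|].
  exact: exprDn_pchar.
by rewrite expr0n gtn_eqF.
Qed.

Lemma count_iota_ltn n m : (m <= n)%N -> count (ltn^~ m) (iota 0 n) = m.
Proof.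
elim: n => [|n IH]; first by rewrite leqn0 => /eqP->.
rewrite -addn1 iotaD count_cat /= add0n addn0 leq_eqVlt => /predU1P[->|].
  rewrite addn1 ltnSn -[RHS]addn1; congr addn.
  rewrite -[RHS](size_iota 0) -count_predT; apply: eq_in_count => i.
  by rewrite mem_iota /= => /ltnW; rewrite -ltnS.
by rewrite addn1 ltnS => le; rewrite IH // ltnNge le addn0.
Qed.

(** * Exponents of the monomials of the Hibi ring and supports of its elements *)

Section Exponents.
Context {k : fieldType} {d : Order.disp_t} {P : finPOrderType d}.
Local Notation PR := {mpoly k[#|P|.+1]}.
Local Notation monom := 'X_{1..#|P|.+1}.
Implicit Types (v w : P -> nat) (I : {set P}) (m : monom) (f g : PR).

(** The exponent of T^n X^v: index [ord0] belongs to T, the others enumerate [P]. *)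
Definition expo n v : monom :=
  [multinom if unlift ord0 i is Some j then v (enum_val j) else n
     | i < #|P|.+1].

Lemma expo0 n v : expo n v ord0 = n.
Proof. by rewrite mnmE unlift_none. Qed.

Lemma expo_lift n v x : expo n v (lift ord0 (enum_rank x)) = v x.
Proof. by rewrite mnmE liftK enum_rankK. Qed.

Lemma eq_expo n v w : v =1 w -> expo n v = expo n w.
Proof. by move=> vw; apply/mnmP => i; rewrite !mnmE; case: unlift. Qed.

Lemma expo_inj n v n' w : expo n v = expo n' w -> n = n' /\ v =1 w.
Proof.
move=> e; split=> [|x]; first by rewrite -(expo0 n v) e expo0.
by rewrite -(expo_lift n v) e expo_lift.
Qed.

Lemma expoD n v n' w :
  (expo n v + expo n' w)%MM = expo (n + n') (fun x => v x + w x)%N.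
Proof. by apply/mnmP => i; rewrite mnmDE !mnmE; case: unlift. Qed.

Lemma expoMn n v q : (expo n v *+ q)%MM = expo (n * q) (fun x => v x * q)%N.
Proof. by apply/mnmP => i; rewrite mulmnE !mnmE; case: unlift. Qed.

Lemma hibi_genE I : hibi_gen I = 'X_[expo 1 (fun x => x \in I)] :> PR.
Proof.
rewrite /hibi_gen /varT /varX -(big_morph _ (@mpolyXD _ k) (@mpolyX0 _ k)).
rewrite -mpolyXD; congr 'X_[_].
apply/mnmP => i; rewrite mnmDE mnm_sumE mnm1E [RHS]mnmE.
case: unliftP => [j ->|->]; last first.
  by rewrite eqxx big1 // => x _; rewrite mnm1E.
rewrite (negPf (neq_lift _ _)) add0n.
rewrite (eq_bigr (fun x => (x == enum_val j) : nat)).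
  case eI: (enum_val j \in I).
    by rewrite (bigD1 (enum_val j)) //= eqxx big1 // => x /andP[_ /negPf->].
  by rewrite big1 // => x xI; case: eqP => // xe; rewrite -xe xI in eI.
by move=> x _; rewrite mnm1E (inj_eq lift_inj) (can2_eq enum_rankK enum_valK).
Qed.

Lemma prod_hibi_gen (l : seq {set P}) :
  \prod_(I <- l) hibi_gen I
  = 'X_[expo (size l) (fun x => count (fun I => x \in I) l)] :> PR.
Proof.
elim: l => [|I l IH].
  rewrite big_nil -mpolyX0; congr 'X_[_].
  by apply/mnmP => i; rewrite !mnmE; case: unlift.
by rewrite big_cons IH hibi_genE -mpolyXD expoD.
Qed.

(** The semigroup of exponents of monomials in R, by [cone_gens] and [hibi_ring_supported]. *)
Definition cone m := exists n w,
  [/\ antitone w, forall x, (w x <= n)%N & m = expo n w].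

Lemma coneD m m' : cone m -> cone m' -> cone (m + m')%MM.
Proof.
move=> [n [w [wa wn ->]]] [n' [w' [wa' wn' ->]]]; rewrite expoD.
exists (n + n')%N, (fun x => w x + w' x)%N; split=> // [x y xy|x].
  by apply: leq_add; [apply: wa|apply: wa'].
exact: leq_add.
Qed.

Lemma cone0 : cone 0%MM.
Proof.
exists 0%N, (fun _ => 0%N); split=> //.
by apply/mnmP => i; rewrite !mnmE; case: unlift.
Qed.

Lemma cone_ideal I : poset_ideal I -> cone (expo 1 (fun x => x \in I)).
Proof.
move=> I_ideal; exists 1%N, (fun x => x \in I : nat); split=> // [x y xy|x].
  case yI: (y \in I) => //.
  by move/forall_inP: I_ideal => /(_ y yI)/forallP/(_ x); rewrite xy /= => ->.
exact: leq_b1.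
Qed.

(** The layers of elements with [i < w x], for [i < n], are ideals because [w] is antitone, and [x]
    lies in exactly [w x] of them. *)
Lemma cone_gens n w : antitone w -> (forall x, (w x <= n)%N) ->
  exists l : seq {set P}, [/\ size l = n, all poset_ideal l
    & 'X_[expo n w] = \prod_(I <- l) hibi_gen I :> PR].
Proof.
move=> wa wn; exists [seq [set x | (i < w x)%N] | i <- iota 0 n].
split; first by rewrite size_map size_iota.
  apply/allP => I /mapP[i _ ->]; apply/forall_inP => x; rewrite inE => ix.
  apply/forallP => y; apply/implyP => yx; rewrite inE.
  exact: leq_trans (wa _ _ yx).
rewrite prod_hibi_gen size_map size_iota; congr 'X_[_]; apply: eq_expo => x.
rewrite count_map -[LHS](count_iota_ltn (wn x)).
by apply: eq_count => i; rewrite /= inE.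
Qed.

Definition supported (S : monom -> Prop) f := forall m, m \in msupp f -> S m.

Lemma supported_sum S (T : eqType) (r : seq T) (F : T -> PR) :
  (forall t, t \in r -> supported S (F t)) -> supported S (\sum_(t <- r) F t).
Proof.
elim: r => [|t r IH] Fr m; first by rewrite big_nil msupp0.
rewrite big_cons => /msuppD_le; rewrite mem_cat => /orP[|].
  exact/Fr/mem_head.
by apply: IH => u ur; apply: Fr; rewrite inE ur orbT.
Qed.

Lemma supportedM (S1 S2 S : monom -> Prop) f g :
  (forall m1 m2, S1 m1 -> S2 m2 -> S (m1 + m2)%MM) ->
  supported S1 f -> supported S2 g -> supported S (f * g).
Proof.
move=> SD Sf Sg m /msuppM_le/allpairsP[[m1 m2] /= [m1f m2g ->]].
by apply: SD; [apply: Sf|apply: Sg].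
Qed.

Lemma supportedX (S : monom -> Prop) m : S m -> supported S 'X_[m].
Proof. by move=> Sm m'; rewrite msuppX inE => /eqP->. Qed.

Lemma supported_exp f q : supported cone f -> supported cone (f ^+ q).
Proof.
move=> Sf; elim: q => [|q IH].
  by rewrite expr0 -mpolyX0; apply: supportedX; exact: cone0.
by rewrite exprS; apply: (supportedM coneD Sf IH).
Qed.

Lemma hibi_ring_supported f : hibi_ring f -> supported cone f.
Proof.
move=> [s [s_ideal ->]]; apply: supported_sum => -[c l] /s_ideal /= l_ideal m.
move/msuppZ_le; move: m; rewrite -/(supported cone _).
elim: l l_ideal => [_|I l IH /= /andP[II /IH{}IH]].
  by rewrite big_nil -mpolyX0; apply: supportedX; exact: cone0.
rewrite big_cons hibi_genE.
exact: supportedM coneD (supportedX (cone_ideal II)) IH.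
Qed.

(** Frobenius is additive, so the [q]-th power of an element of m is a combination of [q]-th powers
    of generators, with coefficients supported in the cone. *)
Lemma hibi_m_frob_supported q f : [pchar k].-nat q -> hibi_m_frob q f ->
  supported (fun m => exists I c, [/\ poset_ideal I, cone c
    & m = (expo 1 (fun x => x \in I) *+ q + c)%MM]) f.
Proof.
move=> q_char [s [sP ->]].
apply: supported_sum => -[a g] /sP[/= aR [x [xm ->]]].
have [t [tP ->]] := xm.
rewrite expr_sum_pchar; last first.
  by apply: sub_in_pnat q_char => p _; apply: (rmorph_pchar (@mpolyC _ k)).
rewrite mulr_sumr; apply: supported_sum => -[b h] /tP[/= bR [I [I_ideal ->]]].
rewrite exprMn mulrA hibi_genE mpolyXn.
apply: supportedM (supportedM coneD (hibi_ring_supported aR)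
  (supported_exp (hibi_ring_supported bR))) (supportedX (erefl _)).
by move=> c _ cc <-; exists I, c; rewrite addmC.
Qed.

Lemma hibi_ring1 : hibi_ring (1 : PR).
Proof.
exists [:: (1, [::])]; split=> [x|]; first by rewrite inE => /eqP->.
by rewrite big_seq1 big_nil scale1r.
Qed.

Lemma hibi_ringM_gens f (l : seq {set P}) : hibi_ring f -> all poset_ideal l ->
  hibi_ring (f * \prod_(I <- l) hibi_gen I).
Proof.
move=> [s [sP ->]] l_ideal.
exists [seq (x.1, x.2 ++ l) | x <- s]; split.
  by move=> _ /mapP[x xs ->] /=; rewrite all_cat sP.
rewrite big_map mulr_suml; apply: eq_bigr => x _.
by rewrite -scalerAl big_cat.
Qed.

Lemma hibi_gen_m I : poset_ideal I -> hibi_m (hibi_gen I : PR).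
Proof.
move=> I_ideal; rewrite /hibi_m -[hibi_gen I]mul1r.
by apply: sub_ideal_mul; [exact: hibi_ring1|exists I].
Qed.

End Exponents.

(** * Upper and lower bounds for nu, and the limit *)

Section Threshold.
Context {d : Order.disp_t} {P : finPOrderType d}.

Lemma leq_rank_star (C : seq P) :
  is_maximal_path C -> star C -> (len_star C <= @rank_star d P)%N.
Proof.
case: C => // x s C_path C_star.
have lts : (size s < #|P|)%N.
  have := max_card (mem (x :: s)).
  by rewrite (card_uniqP (maximal_path_uniq C_path)).
apply: leq_trans (leq_bigmax (Ordinal lts)) => /=.
apply: (leq_bigmax_cond (in_tuple (x :: s))).
by rewrite C_path C_star.
Qed.

Lemma rank_star_attained : (0 < #|P|)%N ->
  exists C : seq P,
    [/\ is_maximal_path C, star C & len_star C = @rank_star d P].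
Proof.
move=> P_gt0.
(* With zero weight, [n = 0] and [q = 1] the first alternative would give [1 <= 0]; hence some
   maximal path satisfies ( * ) and the maximum is not over an empty family. *)
have [[I _ []]//|[C0 [C0_path C0_star _]]] :=
  @ideal_or_star_path d P (fun _ => 0%N) 0 1 (fun _ _ _ => leqnn _)
    (fun _ => leqnn _) isT P_gt0.
have [C' [? ? le]] : exists C : seq P,
    [/\ is_maximal_path C, star C & (@rank_star d P <= len_star C)%N].
  rewrite /rank_star; elim/big_rec: _ => [|t m _ [C [CP CS le]]].
    by exists C0.
  have [C' [C'P C'S le']] : exists C : seq P, [/\ is_maximal_path C, star C
    & (\max_(c : (t.+1).-tuple P | is_maximal_path c && star c) len_star c
       <= len_star C)%N].
    elim/big_rec: _ => [|c m' /andP[cP cS] [D [DP DS leD]]]; first by exists C0.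
    case: (leqP (len_star c) (len_star D)) => [le'|/ltnW le'].
      by exists D; split=> //; rewrite geq_max le' leD.
    by exists c; split=> //; rewrite geq_max leqnn (leq_trans leD).
  case: (leqP (len_star C) (len_star C')) => [l|/ltnW l].
    by exists C'; split=> //; rewrite geq_max le' (leq_trans le).
  by exists C; split=> //; rewrite geq_max le (leq_trans le').
exists C'; split=> //; apply/eqP; rewrite eqn_leq le andbT.
exact: leq_rank_star.
Qed.

Context {k : fieldType}.
Local Notation PR := {mpoly k[#|P|.+1]}.

(** For larger [r] no path with ( * ) meets the bound of [ideal_or_star_path], so each product of
    [r] generators is divisible in R by the [q]-th power of a generator. *)
Lemma not_in_frob_bound q r : (0 < #|P|)%N -> (0 < q)%N ->
  @not_in_frob k d P q r -> (r <= q.-1 * (@rank_star d P + 2))%N.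
Proof.
move=> P_gt0 q_gt0 nin; rewrite leqNgt; apply/negP => ltr; apply: nin => f.
apply: sub_ideal_trans => a _ aR [l [sz_l l_ideal ->]].
pose v x := count (fun I : {set P} => x \in I) l.
have v_anti : antitone v.
  move=> x y xy; rewrite /v; elim: l l_ideal {sz_l v} => //= I l IH.
  case/andP=> /forall_inP I_ideal /IH; apply: leq_add.
  case yI: (y \in I) => //.
  by have /forallP/(_ x) := I_ideal y yI; rewrite xy /= => ->.
have v_le x : (v x <= r)%N by rewrite -sz_l count_size.
have [|[C [CP CS le]]] := ideal_or_star_path v_anti v_le q_gt0 P_gt0;
  last first.
  have := leq_rank_star CP CS; move: ltr; rewrite ltnNge => /negP[].
  by apply: leq_trans le _; rewrite leq_mul2l leq_add2r leq_rank_star ?orbT.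
case=> I I_ideal [leqr in_I out_I gap].
(* The exponent of the quotient; the truncated subtraction is exact by [in_I]. *)
pose w x := (v x - (x \in I) * q)%N.
have w_anti : antitone w.
  move=> x y xy; rewrite /w; have := v_anti _ _ xy; have := gap _ _ xy.
  have : y \in I -> x \in I.
    move=> yI; move/forall_inP: I_ideal => /(_ y yI)/forallP/(_ x).
    by rewrite xy.
  case: (x \in I); case: (y \in I) => //=.
  - by lia.
  - by move=> _ /(_ isT isT); lia.
  - by move=> /(_ isT).
  - by lia.
have w_le x : (w x <= r - q)%N.
  rewrite /w; have := v_le x; have := out_I x.
  by case: (x \in I) => /= [|/(_ isT)]; lia.
have [l' [_ l'_ideal prod_l']] := @cone_gens k d P _ _ w_anti w_le.
have -> : \prod_(I <- l) hibi_gen I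
  = (\prod_(J <- l') hibi_gen J) * hibi_gen I ^+ q :> PR.
  rewrite -prod_l' hibi_genE mpolyXn -mpolyXD prod_hibi_gen expoMn expoD mul1n.
  rewrite sz_l subnK //; congr 'X_[_]; apply: eq_expo => x; rewrite -/(v x) /w.
  by rewrite subnK //; case xI: (x \in I) => //; rewrite mul1n in_I.
rewrite mulrA; apply: sub_ideal_mul; first exact: hibi_ringM_gens.
by exists (hibi_gen I); split=> //; apply: hibi_gen_m.
Qed.

(** The monomial with the weight of [star_path_weight] is a product of that many generators. Were it
    in m^[q], its only exponent would split as that lemma forbids. *)
Lemma not_in_frob_star_path q (C : seq P) : [pchar k].-nat q ->
  is_maximal_path C -> star C ->
  @not_in_frob k d P q (q.-1 * (len_star C + 2)).
Proof.
move=> q_char CP CS; have q_gt0 : (0 < q)%N by case/andP: q_char.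
have [v [v_anti v_le no_ideal]] := star_path_weight q.-1 CP CS.
set n := (q.-1 * _)%N in v_le no_ideal *.
move=> sub; have : @hibi_m_frob k d P q 'X_[expo n v].
  apply: sub; rewrite /hibi_m_pow -['X_[_]]mul1r.
  by apply: sub_ideal_mul; [exact: hibi_ring1|exact: cone_gens].
move/(hibi_m_frob_supported q_char) => /(_ (expo n v)).
rewrite msuppX mem_head => -[//|I [_ [I_ideal [m [w [wa wm ->]]]]]].
rewrite expoMn expoD mul1n => /expo_inj[nE vE].
apply: (no_ideal I w m) => //; first by rewrite prednK.
by move=> y; rewrite prednK // vE.
Qed.

End Threshold.

Lemma rat_cvg_pred_pow_mul p M : (1 < p)%N ->
  rat_cvg (fun e => ((p ^ e).-1 * M)%N%:R / (p ^ e)%:R) M%:R.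
Proof.
move=> p_gt1 eps eps_gt0; exists (Num.Def.archi_bound (M%:R / eps)) => e lee.
have pe_gt0 : (0 < p ^ e)%N by rewrite expn_gt0 ltnW.
have pe_gt0' : 0 < (p ^ e)%:R :> rat by rewrite ltr0n.
have -> : ((p ^ e).-1 * M)%N%:R / (p ^ e)%:R - M%:R
          = - (M%:R / (p ^ e)%:R) :> rat.
  rewrite natrM -subn1 natrB // mulrBl mul1r mulrBl mulrAC divff ?gt_eqF //.
  by rewrite mul1r addrAC subrr add0r.
rewrite normrN ger0_norm ?divr_ge0 ?ler0n //.
rewrite ltr_pdivrMr // mulrC -ltr_pdivrMr //.
have M_ge0 : 0 <= M%:R / eps by rewrite divr_ge0 ?ler0n ?ltW.
apply: lt_trans (archi_boundP M_ge0) _; rewrite ltr_nat.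
exact: leq_ltn_trans lee (ltn_expl _ p_gt1).
Qed.


Theorem theorem2p4 (k : fieldType) (p : nat) (hp : p \in [pchar k])
    (d : Order.disp_t) (P : finPOrderType d) (hP : (0 < #|P|)%N) :
  exists nu : nat -> nat,
    @is_nu k d P p nu /\
    rat_cvg (fun e => (nu e)%:R / (p ^ e)%:R) (@rank_star d P + 2)%:R.
Proof.
have p_prime : prime p := pcharf_prime hp.
have p_gt1 := prime_gt1 p_prime.
exists (fun e => (p ^ e).-1 * (@rank_star d P + 2))%N; split; last first.
  exact: rat_cvg_pred_pow_mul.
move=> e; split; last first.
  by move=> r; apply: not_in_frob_bound => //; rewrite expn_gt0 ltnW.
have [C [CP CS <-]] := rank_star_attained hP.
by apply: not_in_frob_star_path => //; rewrite pnatX pnatE ?hp.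
Qed.
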